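(* Let $n\ge 2$ and let $f_{1,n}, f_{4,n} : [1]\times[2]\times\cdots\times[n]\to S_n$ be the bijections defined in the context. The number of fixed points of the map $f_{1,n}\circ f_{4,n}^{-1}:S_n\to S_n$ is $2$. Namely, the fixed points are exactly the permutations of the form $f_{1,n}(w)=f_{4,n}(w)$, where $w\in[1]\times[2]\times\cdots\times[n]$ is a word such that $w[2]\in\{1,2\}$ and $w[i]=1$ for all $i\ne 2$.
   Context: Notation: $[m]=\{1,2,\dots,m\}$, and $S_n$ is the set of permutations of $[n]$. A permutation $\sigma$ is identified with its one-line notation, and $\sigma[i]$ is its $i$-th entry from the left, i.e. $\sigma[i]$ is the image of $i$ under $\sigma$. In cycle notation, $(a_1a_2\cdots a_k)$ denotes the cycle $a_1\mapsto a_2\mapsto\cdots\mapsto a_k\mapsto a_1$. A word is an element $w\in[1]\times[2]\times\cdots\times[n]$; $w[i]$ is its $i$-th letter from the left, so $1\le w[i]\le i$. Definition of $f_{1,n}$ (recursive): $f_{1,1}(1)=1$. For $n\ge 2$, let $w'$ be the word formed by the first $n-1$ letters of $w$. Then $f_{1,n}(w)$ is the one-line word obtained from the one-line word $f_{1,n-1}(w')$ by inserting $n$ so that it occupies the $w[n]$-th position counting from the right in the resulting word. (Examples for $n=3$: $112\mapsto 132$, $113\mapsto 312$, $121\mapsto 213$.) Definition of $f_{4,n}$ (recursive, in cycle notation): $f_{4,1}(1)=(1)$. For $n\ge 2$, let $w'$ be the word formed by the first $n-1$ letters of $w$. If $w[n]>1$, then $f_{4,n}(w)$ is obtained from the cycle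 notation of $f_{4,n-1}(w')$ by inserting $n$ immediately to the right of the element $w[n]-1$, in the same cycle. If $w[n]=1$, then $f_{4,n}(w)$ is obtained from $f_{4,n-1}(w')$ by adding the new cycle $(n)$. (Examples for $n=3$: $111\mapsto(1)(2)(3)$, $112\mapsto(13)(2)$, $113\mapsto(1)(23)$, $121\mapsto(12)(3)$, $122\mapsto(132)$, $123\mapsto(123)$.) Both maps are bijections. *)

(* Defs.v *)
From mathcomp Require Import all_boot all_fingroup.

Set Implicit Arguments.
Unset Strict Implicit.
Unset Printing Implicit Defensive.

(* Positions and values are shifted by one: the element i of
   [n] = {1, ..., n} is the ordinal i - 1 of 'I_n, so that 'S_n is the set of
   permutations of [n].  In the same way, a word w of [1] x ... x [n] is stored
   as the dependent function sending the ordinal i - 1 to w[i] - 1 in 'I_i. *)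
Definition word (n : nat) := {dffun forall i : 'I_n, 'I_i.+1}.

(* The letter w[i.+1], with values in {1, ..., i.+1}. *)
Definition letter n (w : word n) (i : 'I_n) : nat := (w i).+1.

Definition word_init n (w : word n.+1) : word n :=
  [ffun i : 'I_n => w (widen_ord (leqnSn n) i)].

(* The one-line word of s with the new largest value inserted in position p.+1
   from the right of the resulting word; see [one_line_insert_right]. *)
Definition insert_right n (p : 'I_n.+1) (s : 'S_n) : 'S_n.+1 :=
  lift_perm (rev_ord p) ord_max s.

(* s with the new largest value added as a fixed point. *)
Definition add_cycle n (s : 'S_n) : 'S_n.+1 := lift_perm ord_max ord_max s.

(* The new largest value m is inserted to the right of a in its cycle:
   (... a (s a) ...) becomes (... a m (s a) ...).  Recall that
   (t * u) x = u (t x) in 'S_n. *)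
Definition insert_after n (a : 'I_n) (s : 'S_n) : 'S_n.+1 :=
  (tperm (lift ord_max a) ord_max * add_cycle s)%g.

(* Both recursions start from the empty word and the empty permutation; the
   first step is forced, 'S_1 being trivial. *)
Fixpoint f1 n : word n -> 'S_n :=
  match n with
  | 0 => fun _ => 1%g
  | _.+1 => fun w => insert_right (w ord_max) (f1 (word_init w))
  end.

(* With v = w[n] - 1, [unlift ord0 v] is None when w[n] = 1, and otherwise it is
   Some a with a = w[n] - 2, the ordinal standing for the element w[n] - 1. *)
Fixpoint f4 n : word n -> 'S_n :=
  match n with
  | 0 => fun _ => 1%g
  | _.+1 => fun w =>
      match unlift ord0 (w ord_max) with
      | None => add_cycle (f4 (word_init w))
      | Some a => insert_after a (f4 (word_init w))
      end
  end.

Definition one_line n (s : 'S_n) : seq nat := [seq (s i).+1 | i <- enum 'I_n].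

Lemma one_line_insert_right n (p : 'I_n.+1) (s : 'S_n) :
  one_line (insert_right p s) =
  take (n - p) (one_line s) ++ n.+1 :: drop (n - p) (one_line s).
Proof.
have szl m (t : 'S_m) : size (one_line t) = m by rewrite size_map size_enum_ord.
have nthl m (t : 'S_m) (i : 'I_m) : nth 0 (one_line t) i = (t i).+1.
  by rewrite (nth_map i) ?size_enum_ord // nth_ord_enum.
have le_p : n - p <= n by apply: leq_subr.
apply: (@eq_from_nth _ 0).
  rewrite szl size_cat /= size_take size_drop szl.
  by case: ltnP => [lt_p|ge_p]; rewrite addnS ?subnKC // (eqP (_ : n - (n - p) == 0)) ?subn_eq0 // addn0.
move=> i; rewrite szl => lt_i.
have sz_take : size (take (n - p) (one_line s)) = n - p.
  by rewrite size_takel ?szl.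
rewrite -[i]/(nat_of_ord (Ordinal lt_i)) nthl nth_cat sz_take /insert_right.
have [j ->|->] := unliftP (rev_ord p) (Ordinal lt_i).
  rewrite lift_perm_lift lift_max -nthl /= /bump subSS.
  case: (leqP (n - p) j) => [le_j | lt_j].
    rewrite add1n ltnNge (leq_trans le_j (leqnSn j)) /= subSn //=.
    by rewrite nth_drop subnKC.
  by rewrite add0n lt_j nth_take.
by rewrite lift_perm_id /= subSS ltnn subnn.
Qed.

Lemma insert_after_pred n (a : 'I_n) (s : 'S_n) :
  insert_after a s (lift ord_max a) = ord_max.
Proof. by rewrite permM tpermL lift_perm_id. Qed.

Lemma insert_after_max n (a : 'I_n) (s : 'S_n) :
  insert_after a s ord_max = lift ord_max (s a).
Proof. by rewrite permM tpermR lift_perm_lift. Qed.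

Lemma insert_after_other n (a b : 'I_n) (s : 'S_n) :
  b != a -> insert_after a s (lift ord_max b) = lift ord_max (s b).
Proof.
move=> neq_ba; rewrite permM tpermD ?lift_perm_lift ?neq_lift //.
by rewrite (inj_eq lift_inj) eq_sym.
Qed.

Lemma word_eqP n (w1 w2 : word n.+1) :
  word_init w1 = word_init w2 -> w1 ord_max = w2 ord_max -> w1 = w2.
Proof.
move=> eq_init eq_max; apply/ffunP => i.
have [lt_in | ] := ltnP i n; last first.
  move=> le_ni; suff -> : i = ord_max by [].
  by apply/val_inj/eqP; rewrite /= eqn_leq le_ni -ltnS ltn_ord.
have -> : i = widen_ord (leqnSn n) (Ordinal lt_in) by apply: val_inj.
by move/ffunP/(_ (Ordinal lt_in)): eq_init; rewrite !ffunE.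
Qed.

Lemma card_word n : #|{: word n}| = n`!.
Proof.
rewrite card_dep_ffun foldrE big_map big_enum /= fact_prod big_add1 big_mkord.
by apply: eq_bigr => i _; rewrite card_ord.
Qed.

Lemma f1_inj n : injective (@f1 n).
Proof.
elim: n => [|n IHn] w1 w2 /=; first by move=> _; apply/ffunP; case.
rewrite /insert_right => eq_f.
have eq_p : w1 ord_max = w2 ord_max.
  apply: rev_ord_inj; apply: (@perm_inj _ (lift_perm (rev_ord (w1 ord_max)) ord_max (f1 (word_init w1)))).
  by rewrite {2}eq_f !lift_perm_id.
apply: word_eqP => //; apply: IHn; apply/permP => i.
apply: (@lift_inj _ ord_max).
by rewrite -(lift_perm_lift (rev_ord (w1 ord_max))) eq_f eq_p lift_perm_lift.
Qed.

Lemma add_cycle_inj n : injective (@add_cycle n).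
Proof.
move=> s t eq_st; apply/permP => i; apply: (@lift_inj _ ord_max).
by rewrite -(lift_perm_lift ord_max) -/(add_cycle s) eq_st lift_perm_lift.
Qed.

Lemma f4_inj n : injective (@f4 n).
Proof.
elim: n => [|n IHn] w1 w2 /=; first by move=> _; apply/ffunP; case.
case: unliftP => [a1|] def1; case: unliftP => [a2|] def2 eq_f.
- have eq_a : a1 = a2.
    apply: (@lift_inj _ ord_max); apply: (@perm_inj _ (insert_after a1 (f4 (word_init w1)))).
    by rewrite insert_after_pred eq_f insert_after_pred.
  apply: word_eqP; last by rewrite def1 def2 eq_a.
  by apply/IHn/add_cycle_inj; move: eq_f; rewrite eq_a => /mulgI.
- move/permP/(_ ord_max): eq_f; rewrite insert_after_max lift_perm_id.
  by move/eqP; rewrite eq_sym (negPf (neq_lift _ _)).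
- move/permP/(_ ord_max): eq_f; rewrite insert_after_max lift_perm_id.
  by move/eqP; rewrite (negPf (neq_lift _ _)).
by apply: word_eqP; [apply/IHn/add_cycle_inj | rewrite def1 def2].
Qed.

Lemma f1_bij n : bijective (@f1 n).
Proof. by apply: inj_card_bij (@f1_inj n) _; rewrite card_word card_Sn. Qed.

Lemma f4_bij n : bijective (@f4 n).
Proof. by apply: inj_card_bij (@f4_inj n) _; rewrite card_word card_Sn. Qed.

Lemma f4_surj n (s : 'S_n) : s \in codom (@f4 n).
Proof. by have [g _ gK] := f4_bij n; rewrite -(gK s) codom_f. Qed.

Definition f4_inv n (s : 'S_n) : word n := iinv (f4_surj s).

Lemma f4_invK n : cancel (@f4_inv n) (@f4 n).
Proof. by move=> s; apply: f_iinv. Qed.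

Lemma f4K n : cancel (@f4 n) (@f4_inv n).
Proof. by move=> w; apply/f4_inj/f4_invK. Qed.

(* w[2] is in {1, 2} and w[i] = 1 for all i <> 2. *)
Definition fixed_word n (w : word n) : bool :=
  [forall i : 'I_n,
     if i == 1 :> nat then letter w i \in [:: 1; 2] else letter w i == 1].

(* Main.v *)
Require Import Defs.
From mathcomp Require Import all_boot all_fingroup.
From mathcomp Require Import zify.

(** Put s = f4 w: then s is a fixed point of f1 \o f4_inv exactly when
    f1 w = f4 w, so the theorem says that the words on which f1 and f4 agree are
    the fixed words, of which there are two since only the second letter is
    free.

    To compare f1 w with f4 w, look at where the largest value sits.  With
    everything numbered from 0, let N be the last position and v the last letter
    of w.  Then f1 w has its largest value N in position N - v, while f4 w has it
    in position v - 1, or in position N when v = 0: the cyclic predecessor of v.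
    If f1 w = f4 w, then v = 0 or N + 1 = 2v.  When v = 0 both maps append N as a
    fixed point, and the question descends to the shorter word.  The second case
    is possible for N = 1, and there f1 and f4 always agree.

    For N > 1 the second case is excluded by looking one letter further back
    ([last_letter_of_agreement]).  Put a = v - 1 = N - v.  Removing N from the
    one-line word and from the cycle of the same permutation, one obtains
    f1 u i = f4 u (c i) for the shorter word u, where c is the cycle that moves
    the positions a, a + 1, ..., N - 1 up by one ([remove_max]).  Hence c sends the
    position of N - 1 in f1 u to its position in f4 u, and as N - 1 = 2a this is
    impossible by parity and size, whatever the last letter of u is. *)

Set Implicit Arguments.
Unset Strict Implicit.
Unset Printing Implicit Defensive.

Lemma val_ord_pred n (v : 'I_n.+1) :
  ord_pred v = (if v == 0 :> nat then n else v.-1) :> nat.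
Proof.
have lt_v := ltn_ord v; rewrite /=; case: eqP => [-> | v_neq0].
  by rewrite add0n modn_small.
by rewrite (_ : (v + n.+1).-1 = v.-1 + n.+1) ?modnDr ?modn_small; lia.
Qed.

Lemma f1_max n (w : word n.+1) : f1 w (rev_ord (w ord_max)) = ord_max.
Proof. exact: lift_perm_id. Qed.

(** The two cases of the recursion defining f4 merge here: the largest value
    follows the predecessor of the letter, and being a fixed point amounts to
    following itself. *)
Lemma f4_max n (w : word n.+1) : f4 w (ord_pred (w ord_max)) = ord_max.
Proof.
rewrite /=; case: unliftP => [a|] def_v.
  apply: etrans (insert_after_pred a (f4 (word_init w))).
  congr (insert_after _ _ _).
  by apply: ord_inj; rewrite val_ord_pred def_v lift_max.
rewrite (_ : ord_pred _ = ord_max) ?lift_perm_id //.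
by apply: ord_inj; rewrite val_ord_pred def_v.
Qed.

Lemma insert_right0 n (s : 'S_n) : insert_right ord0 s = add_cycle s.
Proof.
by rewrite /insert_right (_ : rev_ord ord0 = ord_max) //; apply/ord_inj/subn1.
Qed.

Lemma f1_last0 n (w : word n.+1) :
  w ord_max = ord0 -> f1 w = add_cycle (f1 (word_init w)).
Proof. by move=> /= ->; apply: insert_right0. Qed.

Lemma f4_last0 n (w : word n.+1) :
  w ord_max = ord0 -> f4 w = add_cycle (f4 (word_init w)).
Proof. by move=> /= ->; rewrite unlift_none. Qed.

Lemma f4_last_lift n (w : word n.+1) (a : 'I_n) :
  w ord_max = lift ord0 a -> f4 w = insert_after a (f4 (word_init w)).
Proof. by move=> /= ->; rewrite liftK. Qed.

(** Deleting the largest value from a one-line word closes the gap by shifting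
    the later positions, while deleting it from its cycle fills the gap with the
    entry in the last position.  The two results s and t therefore differ by a
    cyclic shift of the positions from a onwards. *)
Lemma remove_max n (p : 'I_n.+2) (a : 'I_n.+1) (s t : 'S_n.+1) (i b : 'I_n.+1) :
    rev_ord p = a :> nat -> insert_right p s = insert_after a t ->
    b = (if i == n :> nat then a : nat else if i < a then i : nat else i.+1)
      :> nat ->
  s i = t b.
Proof.
move=> def_a eq_st def_b; apply: (@lift_inj _ ord_max).
rewrite -(lift_perm_lift (rev_ord p)) -/(insert_right p s) eq_st.
have lt_a := ltn_ord a; have lt_i := ltn_ord i.
have val_x : lift (rev_ord p) i = (a <= i) + i :> nat.
  by rewrite -def_a.
have [eq_in | neq_in] := eqVneq (i : nat) n.
  have -> : lift (rev_ord p) i = ord_max by apply: ord_inj; rewrite val_x /=; lia.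
  have -> : b = a by apply: ord_inj; rewrite def_b eq_in eqxx.
  by rewrite insert_after_max.
rewrite (negPf neq_in) in def_b.
have -> : lift (rev_ord p) i = lift ord_max b.
  by apply: ord_inj; rewrite val_x lift_max def_b; case: ltnP; lia.
apply: insert_after_other; apply/eqP => /(congr1 (@nat_of_ord _)) /= eq_ba.
by move: def_b; case: ltnP; lia.
Qed.

(** Comparing the positions of the largest value only gives 2v = n.+2 for a last
    letter v != 0, which has solutions for even n; the position of the next
    largest value rules them out. *)
Lemma last_letter_of_agreement n (w : word n.+2) :
  0 < n -> f1 w = f4 w -> w ord_max = ord0.
Proof.
move=> n_gt0 eq_f.
have eq_pos : rev_ord (w ord_max) = ord_pred (w ord_max).
  by apply: (@perm_inj _ (f1 w)); rewrite f1_max eq_f f4_max.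
case: (unliftP ord0 (w ord_max)) => [/= a def_v | //].
have v_val : w ord_max = a.+1 :> nat by rewrite def_v.
move/(congr1 (@nat_of_ord _)): eq_pos; rewrite val_ord_pred v_val /= => def_a.
move: eq_f; rewrite (f4_last_lift def_v).
set u := word_init w => eq_f.
have [j f1_j f4_j] : exists2 j : 'I_n.+1,
    f1 u (rev_ord j) = ord_max & f4 u (ord_pred j) = ord_max.
  by exists (u ord_max); [apply: f1_max | apply: f4_max].
have lt_a := ltn_ord a; have lt_j := ltn_ord j.
set i := rev_ord j in f1_j; have i_val : i = n - j :> nat by rewrite /= subSS.
(* The position i of the maximum of f1 u is shifted to c, which is its position
   in f4 u; since n = 2a > 0, each of the three cases of the shift is absurd. *)
set c := if i == n :> nat then a : nat else if i < a then i : nat else i.+1.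
have lt_c : c < n.+1 by rewrite /c; case: eqP => ?; case: (ltnP i a) => ?; lia.
have /(congr1 (@nat_of_ord _)) : Ordinal lt_c = ord_pred j.
  apply: (@perm_inj _ (f4 u)); rewrite f4_j -f1_j.
  exact/esym/(remove_max def_a eq_f).
have n_2a : n = a.*2 by move: def_a; rewrite /= v_val; lia.
rewrite val_ord_pred /= /c i_val => eq_c; exfalso.
by move: eq_c; case: eqP => ?; case: (ltnP (n - j) a) => ?; case: eqP => ?; lia.
Qed.

Lemma perm2_eq (s t : 'S_2) x : s x = t x -> s = t.
Proof.
have two (i j k : 'I_2) : i != k -> j != k -> i = j.
  rewrite -!val_eqE /= => ik jk; apply: ord_inj.
  by have lt_i := ltn_ord i; have lt_j := ltn_ord j; have := ltn_ord k; lia.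
move=> eq_x; apply/permP => i; have [-> // | neq_ix] := eqVneq i x.
by apply: (two _ _ (s x)); [|rewrite eq_x]; rewrite (inj_eq perm_inj).
Qed.

(** With two positions, reversal and cyclic predecessor coincide, so the largest
    value sits at the same place in f1 w and f4 w, whatever w is. *)
Lemma f1_f4_word2 (w : word 2) : f1 w = f4 w.
Proof.
apply: (@perm2_eq _ _ (rev_ord (w ord_max))).
rewrite f1_max (_ : rev_ord _ = ord_pred (w ord_max)) ?f4_max //.
apply: ord_inj; rewrite val_ord_pred /=.
by case: (w ord_max) => [[|[|]]].
Qed.

Definition fixed_letters n (i : 'I_n) : pred 'I_i.+1 :=
  if i == 1 :> nat then predT else pred1 ord0.

(** As w[2] <= 2 for every word, no condition is left on the second letter; the
    fixed words thus form a product of sets of letters, which gives their number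
    and makes the condition hereditary. *)
Lemma fixed_wordE n (w : word n) :
  fixed_word w = (w \in family (@fixed_letters n)).
Proof.
apply: eq_forallb => i; rewrite -[RHS]/(w i \in @fixed_letters n i).
rewrite /fixed_letters /letter.
have := ltn_ord (w i); case: eqP => i_val; last by rewrite inE -val_eqE eqSS.
by rewrite {2}i_val !inE; case: (nat_of_ord (w i)) => [|[]].
Qed.

Lemma fixed_wordS n (w : word n.+1) :
  fixed_word w = fixed_word (word_init w) && ((n == 1) || (w ord_max == ord0)).
Proof.
rewrite !fixed_wordE; apply/familyP/andP => [fw | [/familyP fw lw] i].
  split; first by apply/familyP=> i; rewrite ffunE; apply: (fw (widen_ord _ i)).
  by have := fw ord_max; rewrite /fixed_letters /=; case: eqP.
have [lt_in | le_ni] := ltnP i n.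
  have -> : i = widen_ord (leqnSn n) (Ordinal lt_in) by apply: ord_inj.
  by have := fw (Ordinal lt_in); rewrite ffunE.
have -> : i = ord_max.
  by apply/ord_inj/eqP; rewrite /= eqn_leq le_ni -ltnS ltn_ord.
by rewrite /fixed_letters /=; case: eqP lw.
Qed.

Lemma f1_eq_f4 n (w : word n) : (f1 w == f4 w) = fixed_word w.
Proof.
elim: n w => [|n IHn] w.
  by rewrite eqxx; apply/esym/forallP; case.
rewrite fixed_wordS -IHn; have [last0 | last_neq0] := eqVneq (w ord_max) ord0.
  by rewrite orbT andbT f1_last0 // f4_last0 // (inj_eq (@add_cycle_inj n)).
rewrite orbF; case: n => [|[|n]] in IHn w last_neq0 *.
- by case/eqP: last_neq0; apply: ord1.
- rewrite f1_f4_word2 eqxx andbT; apply/esym/eqP/permP => i.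
  by rewrite !ord1; apply/esym/ord1.
rewrite andbF; apply: contraNF last_neq0 => /eqP eq_f.
exact/eqP/last_letter_of_agreement.
Qed.

Lemma card_fixed_word n : 2 <= n -> #|[set w : word n | fixed_word w]| = 2.
Proof.
move=> n_gt1.
rewrite cardsE (eq_card (@fixed_wordE n)) card_family foldrE big_image /=.
rewrite (bigD1 (Ordinal n_gt1)) //= big1 => [|i neq_i1].
  by rewrite muln1 card_ord.
rewrite -val_eqE /= in neq_i1.
by rewrite /fixed_letters (negPf neq_i1) card1.
Qed.

Theorem theorem4 (n : nat) (hn : 2 <= n) :
  [/\ #|[set s : 'S_n | (@f1 n \o @f4_inv n) s == s]| = 2,
      [set s : 'S_n | (@f1 n \o @f4_inv n) s == s]
        = [set f1 w | w : word n & fixed_word w]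
    & forall w : word n, fixed_word w -> f1 w = f4 w].
Proof.
have agree w : fixed_word w -> @f1 n w = f4 w by rewrite -f1_eq_f4 => /eqP.
have fixE : [set s : 'S_n | (@f1 n \o @f4_inv n) s == s]
              = [set f1 w | w : word n & fixed_word w].
  apply/setP => s; rewrite inE /= -{2}(f4_invK s) f1_eq_f4.
  apply/idP/imsetP => [fw | [w fw ->]].
    by exists (f4_inv s); [rewrite inE | rewrite agree // f4_invK].
  by move: fw; rewrite inE => fw; rewrite (agree w fw) f4K.
split=> //; rewrite fixE (card_imset _ (@f1_inj n)).
exact: card_fixed_word.
Qed.
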